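(* Let $\Lambda$ be a row-finite $k$-graph without sources. For each $n\in\mathbb{Z}^k$ let $D_n=\mathbb{N}\Lambda^0$ be the free commutative monoid on $\Lambda^0$, and for $m\le n$ in $\mathbb{Z}^k$ let $\phi_{m,n}:D_m\to D_n$ be the monoid homomorphism given on generators by $\phi_{m,n}(v)=\sum_{\lambda\in v\Lambda^{n-m}}s(\lambda)$. Then: (i) $T_\Lambda=\varinjlim_{\mathbb{Z}^k}(D_n,\phi_{m,n})$ (the direct limit in commutative monoids); (ii) the monoid $T_\Lambda$ is cancellative.
   Context: **$k$-graphs.** $\mathbb{N}=\{0,1,2,\dots\}$, $k\ge 1$, $e_i$ is the $i$-th standard generator of $\mathbb{N}^k$; $\mathbb{N}^k$ and $\mathbb{Z}^k$ are ordered coordinatewise. A $k$-graph is a countable small category $\Lambda$ with object set $\Lambda^0$ (identified with the identity morphisms), range and source maps $r,s:\Lambda\to\Lambda^0$, and a functor $d:\Lambda\to\mathbb{N}^k$ with the unique factorization property: if $d(\lambda)=m+n$ there are unique $\mu_1,\mu_2\in\Lambda$ with $\lambda=\mu_1\mu_2$, $d(\mu_1)=m$, $d(\mu_2)=n$ (the product $\mu_1\mu_2$ is defined iff $s(\mu_1)=r(\mu_2)$). $v\Lambda^n=\{\lambda: r(\lambda)=v, d(\lambda)=n\}$. $\Lambda$ is row-finite if every $v\Lambda^n$ is finite, and has no sources if every $v\Lambda^n$ is nonempty. **Talented monoid.** $T_\Lambda$ is the commutative monoid generated by symbols $v(n)$ ($v\in\Lambda^0$, $n\in\mathbb{Z}^k$)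 subject to $v(n)=\sum_{\alpha\in v\Lambda^{e_i}}s(\alpha)(n+e_i)$ for all $v$, $n$ and $i\in\{1,\dots,k\}$ with $v\Lambda^{e_i}\neq\emptyset$. A commutative monoid is cancellative if $x+y=x+z$ implies $y=z$. *)

(* Defs.v *)
From HB Require Import structures.
From mathcomp Require Import all_boot all_order all_algebra finmap.
From mathcomp Require Import multiset generic_quotient.
From mathcomp Require Import boolp classical_sets functions cardinality fsbigop.

Set Implicit Arguments.
Unset Strict Implicit.
Unset Printing Implicit Defensive.
Import Order.TTheory GRing.Theory Num.Theory.

Local Open Scope classical_set_scope.
Local Open Scope fset_scope.
Local Open Scope mset_scope.
Local Open Scope ring_scope.

(* The free commutative monoid on [K] is [{mset K}] with multiset sum;
   the generator attached to [a] is [[mset a]]. *)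

HB.instance Definition _ (K : choiceType) := Choice.on {mset K}.
HB.instance Definition _ (K : choiceType) :=
  GRing.isNmodule.Build {mset K} (@msetDA K) (@msetDC K) (@mset0D K).

Section FreeMonoid.
Context {K : choiceType}.
Implicit Types (A B : {mset K}) (M : nmodType).

(* The monoid homomorphism out of [{mset K}] extending [f]. *)
Definition mset_lift {M} (f : K -> M) (A : {mset K}) : M :=
  \sum_(a <- finsupp A) f a *+ A a.

Lemma mset_addE A B a : (A + B) a = (A a + B a)%N.
Proof. by rewrite [A + B]/(msetD A B) msetE2. Qed.

Lemma mset_lift_widen M (f : K -> M) A (X : {fset K}) :
  (finsupp A `<=` X)%fset -> mset_lift f A = \sum_(a <- X) f a *+ A a.
Proof.
move=> sAX; apply: (big_fset_incl _ sAX) => a _.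
by rewrite memNfinsupp => /eqP ->; rewrite mulr0n.
Qed.

Lemma mset_lift_msetD M (f : K -> M) A B :
  mset_lift f (A `+` B)%mset = mset_lift f A + mset_lift f B.
Proof.
pose X := (finsupp A `|` finsupp B `|` finsupp (A `+` B)%mset)%fset.
have sA : (finsupp A `<=` X)%fset.
  by apply/fsubsetP => a aA; rewrite !inE aA.
have sB : (finsupp B `<=` X)%fset.
  by apply/fsubsetP => a aA; rewrite !inE aA orbT.
have sAB : (finsupp (A `+` B)%mset `<=` X)%fset.
  by apply/fsubsetP => a aA; rewrite in_fsetU aA orbT.
rewrite (mset_lift_widen f sA) (mset_lift_widen f sB) (mset_lift_widen f sAB).
by rewrite -big_split; apply: eq_bigr => a _; rewrite msetE2 mulrnDr.
Qed.

Lemma mset_lift_is_nmod_morphism M (f : K -> M) :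
  nmod_morphism (mset_lift f).
Proof.
split; last exact: mset_lift_msetD.
by rewrite (@mset_lift_widen _ f 0 fset0) ?big_seq_fset0// finsupp0.
Qed.

HB.instance Definition _ M (f : K -> M) :=
  GRing.isNmodMorphism.Build {mset K} M (mset_lift f)
    (mset_lift_is_nmod_morphism f).

Lemma mset_lift1 M (f : K -> M) a : mset_lift f [mset a] = f a.
Proof.
rewrite /mset_lift finsupp_msetn /= big_seq_fset1.
by rewrite msetnE eqxx mulr1n.
Qed.

Lemma mset_eq_sum A : A = \sum_(a <- finsupp A) [mset a] *+ A a.
Proof.
apply/fsfunP => b.
have sumE (s : seq K) : (\sum_(a <- s) [mset a] *+ A a : {mset K}) b =
    (\sum_(a <- s) (b == a) * A a)%N.
  elim: s => [|a s IHs]; first by rewrite !big_nil fsfunE.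
  rewrite !big_cons mset_addE IHs; congr addn.
  elim: (A a) => [|n IHn]; first by rewrite muln0 fsfunE.
  by rewrite mulrS mset_addE IHn msetnE mulnS; case: eqP.
rewrite sumE; have [bA|bA] := boolP (b \in finsupp A).
  rewrite (big_fsetD1 b)//= eqxx mul1n big1_fset ?addn0// => a.
  by rewrite !inE eq_sym => /andP[/negbTE -> _].
rewrite big1_fset; first by apply/eqP; rewrite -memNfinsupp.
by move=> a aA _; case: eqP => // eba; rewrite eba aA in bA.
Qed.

Lemma mset_additive_ext M (f g : {additive {mset K} -> M}) :
  (forall a, f [mset a] = g [mset a]) -> f =1 g.
Proof.
move=> fg A; rewrite [A]mset_eq_sum !raddf_sum; apply: eq_bigr => a _.
by rewrite !raddfMn fg.
Qed.

End FreeMonoid.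

Section Presentation.
Context {G : choiceType} (rel : {mset G} -> {mset G} -> Prop).

Inductive congruence : {mset G} -> {mset G} -> Prop :=
| CongRel x y : rel x y -> congruence x y
| CongRefl x : congruence x x
| CongSym x y : congruence x y -> congruence y x
| CongTrans y x z : congruence x y -> congruence y z -> congruence x z
| CongAdd x y x' y' :
    congruence x y -> congruence x' y' -> congruence (x + x') (y + y').

Definition congb (x y : {mset G}) : bool := `[< congruence x y >].

Lemma congb_equiv : equiv_class_of congb.
Proof.
split.
- by move=> x; apply/asboolP/CongRefl.
- by move=> x y; apply/asboolP/asboolP; exact: CongSym.
- move=> y x z /asboolP xy /asboolP yz; apply/asboolP; exact: CongTrans xy yz.
Qed.

Canonical congb_equiv_rel := EquivRelPack congb_equiv.

Definition presented := {eq_quot congb}%qT.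
HB.instance Definition _ := Choice.on presented.

Definition presented_class (x : {mset G}) : presented := \pi_({eq_quot congb})%qT x.

Lemma presented_classP x y :
  presented_class x = presented_class y <-> congruence x y.
Proof.
split=> [/eqquotP/asboolP //|xy]; apply/eqquotP; exact/asboolP.
Qed.

Definition presented_repr (u : presented) : {mset G} :=
  repr (u : {eq_quot congb}%qT).

Lemma presented_reprK : cancel presented_repr presented_class.
Proof. exact: reprK. Qed.

Definition presented_zero : presented := presented_class 0.
Definition presented_add (u v : presented) : presented :=
  presented_class (presented_repr u + presented_repr v).

Lemma presented_class_add x y :
  presented_class (x + y) =
  presented_add (presented_class x) (presented_class y).
Proof.
by apply/presented_classP/CongAdd; apply/presented_classP;
  rewrite presented_reprK.
Qed.

Lemma presented_addA : associative presented_add.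
Proof.
move=> u v w; rewrite -[u]presented_reprK -[v]presented_reprK.
by rewrite -[w]presented_reprK -!presented_class_add addrA.
Qed.

Lemma presented_addC : commutative presented_add.
Proof. by move=> u v; rewrite /presented_add addrC. Qed.

Lemma presented_add0 : left_id presented_zero presented_add.
Proof.
by move=> u; rewrite -[u]presented_reprK -presented_class_add add0r.
Qed.

HB.instance Definition _ :=
  GRing.isNmodule.Build presented presented_addA presented_addC presented_add0.

Lemma presented_class_is_nmod_morphism : nmod_morphism presented_class.
Proof. by split=> // x y; exact: presented_class_add. Qed.

HB.instance Definition _ :=
  GRing.isNmodMorphism.Build {mset G} presented presented_class
    presented_class_is_nmod_morphism.

End Presentation.

Definition cancellative (M : nmodType) :=
  forall x y z : M, x + y = x + z -> y = z.

Record direct_system (I : Type) (le : I -> I -> Prop) := DirectSystem {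
  ds_obj : I -> nmodType;
  ds_map : forall m n, le m n -> {additive ds_obj m -> ds_obj n};
  ds_map_id : forall n (h : le n n), ds_map h =1 id;
  ds_map_comp : forall m n p (hmn : le m n) (hnp : le n p) (hmp : le m p),
    ds_map hnp \o ds_map hmn =1 ds_map hmp
}.

Definition cocone I (le : I -> I -> Prop) (D : direct_system le) (M : nmodType)
    (f : forall n, {additive ds_obj D n -> M}) :=
  forall m n (h : le m n), f n \o ds_map D h =1 f m.

Definition is_direct_limit I (le : I -> I -> Prop) (D : direct_system le)
    (T : nmodType) (psi : forall n, {additive ds_obj D n -> T}) :=
  cocone psi /\
  forall (M : nmodType) (f : forall n, {additive ds_obj D n -> M}), cocone f ->
    exists g : {additive T -> M},
      (forall n, g \o psi n =1 f n) /\
      (forall g' : {additive T -> M}, (forall n, g' \o psi n =1 f n) ->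
         g' =1 g).

Notation Nk k := {ffun 'I_k -> nat}.
Notation Zk k := {ffun 'I_k -> int}.

Definition basis_vec (k : nat) (R : pzSemiRingType) (i : 'I_k) :
  {ffun 'I_k -> R} := [ffun j => (j == i)%:R].

Definition leZk (k : nat) (m n : Zk k) : Prop := forall i, m i <= n i.

(* [n - m] as an element of [Nk k]; meaningful only when [leZk m n]. *)
Definition diffZk (k : nat) (m n : Zk k) : Nk k := [ffun i => `|n i - m i|%N].

(* [kg_comp f g] is the composite [f g], meaningful only when
   [kg_src f = kg_rng g]; its other values are unconstrained and unused.
   Countability of the category is the [countType] structure on [kg_mor]. *)
Record kgraph (k : nat) := KGraph {
  kg_vert : countType;
  kg_mor : countType;
  kg_rng : kg_mor -> kg_vert;
  kg_src : kg_mor -> kg_vert;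
  kg_id : kg_vert -> kg_mor;
  kg_comp : kg_mor -> kg_mor -> kg_mor;
  kg_deg : kg_mor -> Nk k;
  kg_rng_id : forall v, kg_rng (kg_id v) = v;
  kg_src_id : forall v, kg_src (kg_id v) = v;
  kg_rng_comp : forall f g, kg_src f = kg_rng g ->
    kg_rng (kg_comp f g) = kg_rng f;
  kg_src_comp : forall f g, kg_src f = kg_rng g ->
    kg_src (kg_comp f g) = kg_src g;
  kg_comp_idl : forall f, kg_comp (kg_id (kg_rng f)) f = f;
  kg_comp_idr : forall f, kg_comp f (kg_id (kg_src f)) = f;
  kg_compA : forall f g h, kg_src f = kg_rng g -> kg_src g = kg_rng h ->
    kg_comp f (kg_comp g h) = kg_comp (kg_comp f g) h;
  kg_deg_id : forall v, kg_deg (kg_id v) = 0;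
  kg_deg_comp : forall f g, kg_src f = kg_rng g ->
    kg_deg (kg_comp f g) = kg_deg f + kg_deg g;
  kg_factorization : forall f m n, kg_deg f = m + n ->
    exists! p : kg_mor * kg_mor,
      [/\ kg_src p.1 = kg_rng p.2, f = kg_comp p.1 p.2,
          kg_deg p.1 = m & kg_deg p.2 = n]
}.

Section KGraph.
Context {k : nat} (L : kgraph k).
Implicit Types (v : kg_vert L) (m n p : Zk k).

Definition paths_from v (n : Nk k) : set (kg_mor L) :=
  [set f | kg_rng f = v /\ kg_deg f = n].

Definition row_finite := forall v (n : Nk k), finite_set (paths_from v n).
Definition no_sources := forall v (n : Nk k), paths_from v n !=set0.

(* The generator [v(n)] is [[mset (v, n)]].  The sums over [paths_from], here
   and in [phi], are the intended ones when [L] is row-finite. *)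
Inductive talented_rel :
    {mset (kg_vert L * Zk k)} -> {mset (kg_vert L * Zk k)} -> Prop :=
| TalentedRel v n (i : 'I_k) : paths_from v (basis_vec nat i) !=set0 ->
    talented_rel [mset (v, n)]
      (\sum_(f \in paths_from v (basis_vec nat i))
         [mset (kg_src f, n + basis_vec int i)]).

Definition talented_monoid : nmodType := presented talented_rel.

(* The homomorphism sending the generator [v] to the class of [v(n)]. *)
Definition talented_map n : {additive {mset (kg_vert L)} -> talented_monoid} :=
  mset_lift (fun v => presented_class talented_rel [mset (v, n)]).

Definition phi m n : {additive {mset (kg_vert L)} -> {mset (kg_vert L)}} :=
  mset_lift (fun v =>
    \sum_(f \in paths_from v (diffZk m n)) [mset (kg_src f)]).

Lemma kg_fact_eq (f1 g1 f2 g2 : kg_mor L) :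
  kg_src f1 = kg_rng g1 -> kg_src f2 = kg_rng g2 ->
  kg_comp f1 g1 = kg_comp f2 g2 ->
  kg_deg f1 = kg_deg f2 -> kg_deg g1 = kg_deg g2 -> f1 = f2 /\ g1 = g2.
Proof.
move=> c1 c2 e12 df dg.
have [p [_ up]] := kg_factorization (kg_deg_comp c1).
have e1 := up (f1, g1) (And4 c1 erefl erefl erefl).
have e2 := up (f2, g2) (And4 c2 e12 (esym df) (esym dg)).
by move: e2; rewrite e1 => -[].
Qed.

Lemma deg0_id (f : kg_mor L) : kg_deg f = 0 -> f = kg_id (kg_rng f).
Proof.
move=> f0.
by have [] := @kg_fact_eq f (kg_id (kg_src f)) (kg_id (kg_rng f)) f;
  rewrite ?kg_rng_id ?kg_src_id ?kg_comp_idl ?kg_comp_idr ?kg_deg_id ?f0.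
Qed.

Lemma paths_from0 v : paths_from v 0 = [set kg_id v].
Proof.
apply/seteqP; split=> f /=; first by move=> [<- /deg0_id].
by move=> ->; split; rewrite ?kg_rng_id ?kg_deg_id.
Qed.

Lemma phi_id n : phi n n =1 id.
Proof.
apply: (@mset_additive_ext _ _ (phi n n) idfun) => v.
have -> : phi n n [mset v] = _ := mset_lift1 _ _.
have -> : diffZk n n = 0 by apply/ffunP => i; rewrite !ffunE subrr.
by rewrite paths_from0 fsbig_set1 kg_src_id.
Qed.

Lemma diffZkD m n p : leZk m n -> leZk n p ->
  diffZk m p = diffZk m n + diffZk n p.
Proof.
move=> mn np; apply/ffunP => i; rewrite !ffunE; apply/eqP.
have [mi ni] := (mn i, np i).
rewrite -eqz_nat PoszD !gez0_abs ?subr_ge0 ?(le_trans mi)//.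
by rewrite [X in _ == X]addrC addrA subrK.
Qed.

Lemma sum_pathsD (fin : row_finite) (M : nmodType) (F : kg_vert L -> M)
    v (a b : Nk k) :
  \sum_(h \in paths_from v (a + b)) F (kg_src h) =
  \sum_(f \in paths_from v a)
    \sum_(g \in paths_from (kg_src f) b) F (kg_src g).
Proof.
rewrite fsbig_finite; last exact: fin.
rewrite [RHS]fsbig_finite; last exact: fin.
rewrite [RHS](eq_bigr (fun f : kg_mor L =>
    \sum_(g <- fset_set (paths_from (kg_src f) b)) F (kg_src g))); last first.
  by move=> f _; rewrite fsbig_finite//; exact: fin.
pose r1 : seq (kg_mor L) := fset_set (paths_from v a).
pose r2 f : seq (kg_mor L) := fset_set (paths_from (kg_src f) b).
have mem1 f : (f \in r1) = (f \in paths_from v a).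
  by rewrite in_fset_set//; exact: fin.
have mem2 f g : (g \in r2 f) = (g \in paths_from (kg_src f) b).
  by rewrite in_fset_set//; exact: fin.
transitivity (\sum_(h <- [seq kg_comp f g | f <- r1, g <- r2 f]) F (kg_src h)).
  apply: perm_big; apply: uniq_perm; first exact: fset_uniq.
    apply: allpairs_uniq_dep; first exact: fset_uniq.
      by move=> f _; exact: fset_uniq.
    move=> _ _ /allpairsPdep[f [g [+ + ->]]] /allpairsPdep[f' [g' [+ + ->]]].
    rewrite !mem1 !mem2 !inE => -[_ df] [rg dg] [_ df'] [rg' dg'] /= e.
    have [-> -> //] : f = f' /\ g = g'.
      by apply: kg_fact_eq e _ _; rewrite ?df ?df' ?dg ?dg'.
  move=> h; rewrite in_fset_set; last exact: fin.
  apply/idP/allpairsPdep => [|[f [g []]]].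
    rewrite inE => -[rh dh].
    have [[f g] [/= [c e df dg] _]] := kg_factorization dh.
    exists f, g; rewrite mem1 mem2 !inE; split=> //; split=> //.
    by rewrite -rh e kg_rng_comp.
  rewrite mem1 mem2 !inE => -[rf df] [rg dg] ->.
  by split; rewrite ?kg_rng_comp ?kg_deg_comp ?df ?dg.
rewrite big_allpairs_dep; apply: eq_big_seq => f; rewrite mem1 inE => -[_ _].
by apply: eq_big_seq => g; rewrite mem2 inE => -[rg _]; rewrite kg_src_comp.
Qed.

Lemma phi_comp (fin : row_finite) m n p : leZk m n -> leZk n p ->
  phi n p \o phi m n =1 phi m p.
Proof.
move=> mn np; apply: (@mset_additive_ext _ _ (phi n p \o phi m n) (phi m p)).
move=> v /=.
have phi1 i j u : phi i j [mset u] = _ := mset_lift1 _ _.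
rewrite !phi1 (diffZkD mn np) (sum_pathsD fin (fun u => [mset u])).
rewrite [RHS]fsbig_finite; last exact: fin.
rewrite fsbig_finite; last exact: fin.
by rewrite raddf_sum; apply: eq_bigr => f _; rewrite phi1.
Qed.

Definition talented_system (fin : row_finite) : direct_system (@leZk k) :=
  @DirectSystem _ _ (fun _ => {mset (kg_vert L)}) (fun m n _ => phi m n)
    (fun n _ => @phi_id n)
    (fun m n p hmn hnp _ => phi_comp fin hmn hnp).

End KGraph.

(* Main.v *)
Require Import Defs.
From mathcomp Require Import all_boot all_order all_algebra.
From HB Require Import structures.
From mathcomp Require Import finmap multiset.
From mathcomp Require Import boolp classical_sets functions cardinality fsbigop.

(** Write [v(n)] for the generator of the talented monoid attached to the
    vertex [v] and the degree [n].  Iterating the defining relations along a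
    decomposition of [d] into basis vectors, and using unique factorization to
    regroup the double sums over paths, gives [v(n) = \sum_f (s f)(n + d)] over
    all paths [f] of degree [d] from [v] ([talented_expand]); the absence of
    sources makes every one of these relations available.  This is the cocone
    identity.  Conversely the relations of the talented monoid are the cocone
    identities for [n <= n + e_i], so a cocone induces a unique homomorphism out
    of the talented monoid.

    For cancellation, push every generator [v(n)] occurring in a formal sum to
    a common degree [N] with [phi n N]; the result [push N x] lies in the free
    commutative monoid on the vertices.  Two facts relate it to the class of
    [x]: congruent sums have equal pushes for all large [N]
    ([congruence_push]), and the class of [x] is recovered from [push N x] for
    all large [N] ([class_push]).  As free commutative monoids are cancellative,
    so is the talented monoid. *)

Set Implicit Arguments.
Unset Strict Implicit.
Unset Printing Implicit Defensive.
Import Order.TTheory GRing.Theory Num.Theory.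

Local Open Scope classical_set_scope.
Local Open Scope mset_scope.
Local Open Scope ring_scope.

Lemma raddf_fsbig (U V : nmodType) (h : {additive U -> V}) (T : choiceType)
    (A : set T) (F : T -> U) : finite_set A ->
  h (\sum_(i \in A) F i) = \sum_(i \in A) h (F i).
Proof. by move=> finA; rewrite !fsbig_finite// raddf_sum. Qed.

Lemma mset_ind (K : choiceType) (P : {mset K} -> Prop) :
  P 0 -> (forall x y, P x -> P y -> P (x + y)) -> (forall a, P [mset a]) ->
  forall x, P x.
Proof.
move=> P0 PD P1 x; rewrite [x]mset_eq_sum.
apply: (big_ind P) => // a _.
by elim: (x a) => [|n IHn]; rewrite ?mulr0n// mulrS; apply: PD.
Qed.

Lemma mset_cancellative (K : choiceType) : cancellative {mset K}.
Proof.
move=> x y z /fsfunP xyz; apply/fsfunP => a.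
by have := xyz a; rewrite !mset_addE => /addnI.
Qed.

Section PresentedLift.
Context {G : choiceType} (rel : {mset G} -> {mset G} -> Prop).
Context {M : nmodType} (h : {additive {mset G} -> M}).
Hypothesis h_rel : forall x y, rel x y -> h x = h y.

Lemma congruence_lift x y : congruence rel x y -> h x = h y.
Proof.
elim=> {x y} [x y /h_rel //|//|//|y x z _ -> //|x y x' y' _ exy _ exy'].
by rewrite !raddfD exy exy'.
Qed.

(** The map induced by [h], through chosen representatives; [lift_class] says
    that the choice does not matter. *)
Let lift (u : presented rel) : M := h (presented_repr u).

Let lift_class x : lift (presented_class rel x) = h x.
Proof.
by apply/congruence_lift/presented_classP; rewrite presented_reprK.
Qed.

(** The universal property of a presentation: a homomorphism out of the free
    commutative monoid that respects the relations factors through the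
    presented monoid. *)
Lemma presented_factor :
  exists g : {additive presented rel -> M},
    forall x, g (presented_class rel x) = h x.
Proof.
have lift_morph : nmod_morphism lift.
  split=> [|u v]; first by rewrite lift_class raddf0.
  rewrite -[u]presented_reprK -[v]presented_reprK.
  by rewrite -(raddfD (presented_class rel)) !lift_class raddfD.
pose mixin := GRing.isNmodMorphism.Build _ _ lift lift_morph.
pose g : {additive presented rel -> M} := HB.pack lift mixin.
by exists g => x; exact: lift_class.
Qed.

End PresentedLift.

Section TalentedLimit.
Context {k : nat} {L : kgraph k}.
Hypothesis fin : row_finite L.
Implicit Types (m n p N : Zk k) (v : kg_vert L) (d : Nk k).
Implicit Types (x y : {mset (kg_vert L * Zk k)}).

(** The inclusion of [Nk k] into [Zk k]. *)
Definition int_vec d : Zk k := [ffun i => (d i)%:Z].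

Lemma leZk_int_vec n d : leZk n (n + int_vec d).
Proof. by move=> i; rewrite !ffunE lerDl. Qed.

Lemma diffZk_int_vec n d : diffZk n (n + int_vec d) = d.
Proof. by apply/ffunP => i; rewrite !ffunE addrC addKr. Qed.

Lemma int_vec_diffZk m n : leZk m n -> m + int_vec (diffZk m n) = n.
Proof.
move=> mn; apply/ffunP => i; rewrite !ffunE gez0_abs ?subr_ge0//.
by rewrite addrCA subrr addr0.
Qed.

Lemma int_vec_basis i : int_vec (basis_vec nat i) = basis_vec int i.
Proof. by apply/ffunP => j; rewrite !ffunE; case: (_ == _). Qed.

Lemma int_vecD d d' : int_vec (d + d') = int_vec d + int_vec d'.
Proof. by apply/ffunP => j; rewrite !ffunE PoszD. Qed.

Lemma phi_gen m n v :
  phi L m n [mset v] =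
  \sum_(f \in paths_from v (diffZk m n)) [mset kg_src f].
Proof. exact: mset_lift1. Qed.

Lemma phi_basis n v (i : 'I_k) :
  phi L n (n + basis_vec int i) [mset v] =
  \sum_(f \in paths_from v (basis_vec nat i)) [mset kg_src f].
Proof. by rewrite phi_gen -int_vec_basis diffZk_int_vec. Qed.

(** Induction on the sum of the coordinates. *)
Lemma Nk_ind (P : Nk k -> Prop) :
  P 0 -> (forall i d, P d -> P (basis_vec nat i + d)) -> forall d, P d.
Proof.
move=> P0 PS d; have [s] := ubnP (\sum_i d i)%N; elim: s d => // s IHs d ds.
have [d0|/existsP[i di]] := boolP [forall i, d i == 0%N].
  suff -> : d = 0 by [].
  by apply/ffunP => i; rewrite ffunE; exact/eqP/(forallP d0).
pose d' : Nk k := [ffun j => d j - (j == i)]%N.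
have dE : d = basis_vec nat i + d'.
  apply/ffunP => j; rewrite !ffunE; case: eqP => [->|_] /=.
    by rewrite [RHS]subnKC// lt0n.
  by rewrite subn0 [RHS]add0n.
rewrite dE; apply/PS/IHs; apply: leq_trans _ (ds : _ <= s)%N.
rewrite (bigD1 i)//= [X in (_ < X)%N](bigD1 i)//= -addSn leq_add//.
  by rewrite ffunE eqxx subn1 prednK// lt0n.
by apply: leq_sum => j _; rewrite ffunE leq_subr.
Qed.

(** The generator [v(n)] of the talented monoid. *)
Definition gen v n : talented_monoid L :=
  presented_class (@talented_rel _ L) [mset (v, n)].

Lemma talented_map_gen n v : talented_map L n [mset v] = gen v n.
Proof. exact: mset_lift1. Qed.

Section NoSources.
Hypothesis nosrc : no_sources L.

(** The defining relations of the talented monoid, extended from the basis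
    vectors to all degrees [d]. *)
Lemma talented_expand d v n :
  gen v n = \sum_(f \in paths_from v d) gen (kg_src f) (n + int_vec d).
Proof.
elim/Nk_ind: d v n => [v n|i d IHd v n].
  rewrite paths_from0 fsbig_set1 kg_src_id; congr (gen v _).
  by apply/ffunP => j; rewrite !ffunE addr0.
rewrite (sum_pathsD fin (fun u => gen u (n + int_vec (basis_vec nat i + d)))).
have /presented_classP := CongRel (TalentedRel n (nosrc v (basis_vec nat i))).
rewrite -/(gen v n) => ->.
rewrite (raddf_fsbig (presented_class (@talented_rel _ L)))//.
apply: eq_fsbigr => f _.
by rewrite -[LHS]/(gen (kg_src f) (n + basis_vec int i)) IHd int_vecD addrA int_vec_basis.
Qed.

Lemma talented_map_phi m n : leZk m n ->
  talented_map L n \o phi L m n =1 talented_map L m.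
Proof.
move=> mn.
apply: (mset_additive_ext
  (f := talented_map L n \o phi L m n) (g := talented_map L m)) => v /=.
rewrite talented_map_gen phi_gen raddf_fsbig//.
rewrite (talented_expand (diffZk m n)) int_vec_diffZk//.
by apply: eq_fsbigr => f _; rewrite talented_map_gen.
Qed.

End NoSources.

(** The formal sum [x] with every generator [v(n)] moved to degree [N]; only
    meaningful when [N] dominates the degrees occurring in [x]. *)
Definition push N : {additive {mset (kg_vert L * Zk k)} -> {mset (kg_vert L)}} :=
  mset_lift (fun a => phi L a.2 N [mset a.1]).

Lemma push_gen N v n : push N [mset (v, n)] = phi L n N [mset v].
Proof. exact: mset_lift1. Qed.

(** [P] holds for all sufficiently large degrees. *)
Definition eventually (P : Zk k -> Prop) :=
  exists N0, forall N, leZk N0 N -> P N.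

Lemma eventually2 (P Q R : Zk k -> Prop) :
  (forall N, P N -> Q N -> R N) -> eventually P -> eventually Q -> eventually R.
Proof.
move=> PQR [N1 PN1] [N2 QN2]; exists [ffun i => Num.max (N1 i) (N2 i)] => N le_N.
by apply: PQR; [apply: PN1|apply: QN2] => i; have := le_N i;
  rewrite ffunE ge_max => /andP[].
Qed.

Lemma eventually_ex (P : Zk k -> Prop) : eventually P -> exists N, P N.
Proof. by move=> [N PN]; exists N; apply: PN => i. Qed.

(** A defining relation at [v(n)] in direction [i] is respected by [push N] as
    soon as [n + e_i <= N], since [phi n N] then factors through the degree
    [n + e_i]. *)
Lemma congruence_push x y : congruence (@talented_rel _ L) x y ->
  eventually (fun N => push N x = push N y).
Proof.
elim=> {x y}
  [_ _ [v n i _]|x|x y _ [N0 exy]|y x z _ exy _ eyz|x y x' y' _ exy _ exy'].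
- exists (n + basis_vec int i) => N le_N.
  rewrite push_gen raddf_fsbig//.
  have le_n : leZk n (n + basis_vec int i).
    by rewrite -int_vec_basis; exact: leZk_int_vec.
  rewrite -[LHS](phi_comp fin le_n le_N [mset v]) /=.
  rewrite (phi_basis n v i).
  rewrite [LHS]raddf_fsbig; last exact: fin.
  by apply: eq_fsbigr => f _; rewrite push_gen.
- by exists 0.
- by exists N0 => N /exy.
- by apply: eventually2 exy eyz => N -> ->.
- by apply: eventually2 exy exy' => N e e'; rewrite !raddfD e e'.
Qed.

Lemma class_push (nosrc : no_sources L) x :
  eventually (fun N =>
    talented_map L N (push N x) = presented_class (@talented_rel _ L) x).
Proof.
elim/mset_ind: x => [|x y ex ey|[v n]].
- by exists 0 => N _; rewrite !raddf0.
- by apply: eventually2 ex ey => N ex ey; rewrite !raddfD ex ey.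
- exists n => N nN; rewrite push_gen.
  by have := talented_map_phi nosrc nN [mset v]; rewrite /= talented_map_gen.
Qed.

Lemma talented_cancellative (nosrc : no_sources L) :
  cancellative (talented_monoid L).
Proof.
move=> u v w.
rewrite -[u]presented_reprK -[v]presented_reprK -[w]presented_reprK.
move: (presented_repr u) (presented_repr v) (presented_repr w) => x y z.
rewrite -!raddfD => /presented_classP/congruence_push exyz.
have eyz : eventually (fun N => push N y = push N z).
  have [N0 e] := exyz; exists N0 => N /e.
  rewrite !raddfD; exact: mset_cancellative.
have [N [eN [yN zN]]] := eventually_ex (eventually2 (fun=> @conj _ _) eyz
  (eventually2 (fun=> @conj _ _) (class_push nosrc y) (class_push nosrc z))).
by rewrite -yN eN zN.
Qed.

(** A cocone [f] corresponds to the homomorphism sending [v(n)] to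
    [f n [mset v]]. *)
Lemma talented_universal (M : nmodType)
    (f : forall n, {additive {mset (kg_vert L)} -> M}) :
  (forall m n, leZk m n -> f n \o phi L m n =1 f m) ->
  exists g : {additive talented_monoid L -> M},
    (forall n, g \o talented_map L n =1 f n) /\
    (forall g' : {additive talented_monoid L -> M},
      (forall n, g' \o talented_map L n =1 f n) -> g' =1 g).
Proof.
move=> fphi.
pose h : {additive {mset (kg_vert L * Zk k)} -> M} :=
  mset_lift (fun a => f a.2 [mset a.1]).
have h1 v n : h [mset (v, n)] = f n [mset v] by exact: mset_lift1.
have h_rel x y : talented_rel x y -> h x = h y.
  case=> v n i _; rewrite h1 raddf_fsbig//.
  have le_n : leZk n (n + basis_vec int i).
    by rewrite -int_vec_basis; exact: leZk_int_vec.
  rewrite -[LHS](fphi _ _ le_n [mset v]) /=.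
  rewrite (phi_basis n v i).
  rewrite [LHS]raddf_fsbig; last exact: fin.
  by apply: eq_fsbigr => g _; rewrite h1.
have [g gh] := presented_factor h_rel.
exists g; split=> [n|g' g'f].
  apply: (mset_additive_ext (f := g \o talented_map L n) (g := f n)) => v /=.
  by rewrite talented_map_gen gh h1.
move=> u; rewrite -[u]presented_reprK; move: (presented_repr u) => x.
apply: (mset_additive_ext (f := g' \o presented_class _)
  (g := g \o presented_class _)) => -[v n] /=.
by rewrite gh h1 -g'f /= talented_map_gen.
Qed.

End TalentedLimit.

Theorem proposition3p14 (k : nat) (hk : (0 < k)%N) (L : kgraph k)
  (fin : row_finite L) (nosrc : no_sources L) :
  is_direct_limit (D := talented_system fin) (T := talented_monoid L)
    (fun n => talented_map L n) /\
  cancellative (talented_monoid L).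
Proof.
split; last exact: talented_cancellative.
split; first by move=> m n mn; exact: talented_map_phi.
by move=> M f fcocone; apply: talented_universal.
Qed.
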